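(* Let $R$ be an integral domain which is not a field. Then $R$ is an FC-domain if and only if each chain of distinct $t$-linked overrings of $R$ is finite.
   Context: Let $L$ be the quotient field of $R$. An overring of $R$ is a ring $T$ with $R\subseteq T\subseteq L$. For an ideal $I$ of $R$, $I^{-1}=(R:I)=\{x\in L : xI\subseteq R\}$, and for an overring $T$, $(T:IT)=\{x\in L: xIT\subseteq T\}$. An overring $T$ of $R$ is $t$-linked over $R$ if, for each finitely generated ideal $I$ of $R$, $I^{-1}=R$ implies $(T:IT)=T$. $R$ is an FC-domain if each chain (with respect to inclusion) of distinct overrings of $R$ is finite. *)

(* Defs.v *)
From HB Require Import structures.
From mathcomp Require Import all_boot all_algebra.
From mathcomp Require Import boolp classical_sets functions cardinality.

Set Implicit Arguments.
Unset Strict Implicit.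
Unset Printing Implicit Defensive.

Import GRing.Theory.
Local Open Scope classical_set_scope.
Local Open Scope ring_scope.

Definition base_ring (R : idomainType) : set {fraction R} := range (@tofrac R).
Arguments base_ring R : clear implicits.

Definition is_overring (R : idomainType) (T : set {fraction R}) : Prop :=
  subring_closed [in T] /\ base_ring R `<=` T.

Definition fg_ideal (R : comNzRingType) (I : set R) : Prop :=
  exists (n : nat) (a : 'I_n -> R),
    I = [set x | exists c : 'I_n -> R, x = \sum_(i < n) c i * a i].

(* The product AB of two subsets: all finite sums of products a * b. *)
Definition set_product (K : comNzRingType) (A B : set K) : set K :=
  [set x | exists (n : nat) (a b : 'I_n -> K),
    [/\ forall i, A (a i), forall i, B (b i) & x = \sum_(i < n) a i * b i]].

Definition colon (K : comNzRingType) (A B : set K) : set K :=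
  [set x | forall b, B b -> A (x * b)].

Definition ideal_inverse (R : idomainType) (I : set R) : set {fraction R} :=
  colon (base_ring R) (@tofrac R @` I).

Definition ideal_extension (R : idomainType) (I : set R)
    (T : set {fraction R}) : set {fraction R} :=
  set_product (@tofrac R @` I) T.

Definition t_linked_overring (R : idomainType) (T : set {fraction R}) : Prop :=
  is_overring T /\
  forall I : set R, fg_ideal I -> ideal_inverse I = base_ring R ->
    colon T (ideal_extension I T) = T.

(* Every chain of members of the family F is finite.  A chain is a set of
   subsets, so its members are pairwise distinct. *)
Definition finite_chains (U : Type) (F : set (set U)) : Prop :=
  forall C : set (set U), C `<=` F -> total_on C subset -> finite_set C.

Definition FC_domain (R : idomainType) : Prop :=
  finite_chains (@is_overring R).

(* Main.v *)
(* A finitely generated ideal I with I^-1 = R and I <> R lies in the radical of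
   no principal ideal (x) with x in I.  So each x in I lies in an ideal P that is
   maximal among the ideals whose radical does not contain I; such P are prime
   and pairwise incomparable, and finitely many of them never cover I.  Hence
   the localizations of R at complements of finite unions of these primes have
   no minimal member.  Localizations are t-linked, so an infinite chain of
   t-linked overrings arises unless I^-1 = R forces I = R, in which case every
   overring is t-linked. *)
Require Import Defs.
From mathcomp Require Import all_boot all_algebra.
From mathcomp Require Import boolp cardinality.
From mathcomp Require Import ring.
From mathcomp Require Import classical_sets.

Set Implicit Arguments.
Unset Strict Implicit.
Unset Printing Implicit Defensive.

Import GRing.Theory.
Local Open Scope classical_set_scope.
Local Open Scope ring_scope.

(** * Zorn's lemma above a given set, and minimal members from finite chains *)

Lemma Zorn_above (T : Type) (P : set (set T)) (A0 : set T) :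
  P A0 ->
  (forall F, F `<=` P -> F A0 -> total_on F subset -> P (\bigcup_(X in F) X)) ->
  exists A, [/\ A0 `<=` A, P A & forall B, A `<=` B -> P B -> B `<=` A].
Proof.
move=> PA0 chainP.
have [F FP Ftot|A [PA maxA]] := @Zorn_bigcup T [set X | P (X `|` A0)].
  (* [A0] is itself a member of [G], so the empty chain is covered too: its union becomes [A0]. *)
  pose G := [set Y | Y = A0 \/ exists2 X, F X & Y = X `|` A0].
  rewrite /mkset; have -> : (\bigcup_(X in F) X) `|` A0 = \bigcup_(Y in G) Y.
    apply/seteqP; split => [t [[X FX Xt]|At]|t [Y [->|[X FX ->]] Yt]].
    - by exists (X `|` A0); [right; exists X|left].
    - by exists A0; [left|].
    - by right.
    - by case: Yt => [Xt|]; [left; exists X|right].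
  apply: chainP => [Y [->|[X FX ->]]||Y Z]; [by []|exact: FP|by left|].
  move=> [->|[X FX ->]] [->|[X' FX' ->]].
  - by left.
  - by left; exact: subsetUr.
  - by right; exact: subsetUr.
  - by case: (Ftot _ _ FX FX') => h; [left|right]; apply: setSU.
exists (A `|` A0); split => // B AB PB.
apply: contrapT => nBA; apply: (maxA B).
  split; first by move=> t At; apply: AB; left.
  by move=> BA; apply: nBA => t /BA; left.
by rewrite /mkset setUidl // => t At; apply: AB; right.
Qed.

Lemma decreasing_range_infinite (U : Type) (f : nat -> set U) :
  (forall n, f n.+1 `<` f n) ->
  total_on (range f) subset /\ ~ finite_set (range f).
Proof.
move=> fS.
have fle m k : f (m + k)%N `<=` f m.
  elim: k => [|k IHk]; first by rewrite addn0.
  by rewrite addnS; apply: subset_trans IHk; case: (fS (m + k)%N).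
have flt m n : (m < n)%N -> f n <> f m.
  move=> /subnKC <- e; case: (fS m) => _; apply.
  by rewrite -e; exact: fle.
split=> [_ _ [m _ <-] [n _ <-]|ffin].
  by case: (leqP m n) => [|/ltnW] /subnKC <-; [right|left]; exact: fle.
apply: infinite_nat; rewrite (_ : setT = f @^-1` range f).
  apply: finite_preimage ffin => m n _ _ e.
  case: (ltngtP m n) => // [/flt|/flt]; first by rewrite e.
  by rewrite e.
by apply/seteqP; split => // n _; exists n.
Qed.

(** Otherwise choosing a smaller member again and again gives a strictly decreasing sequence in [G],
    whose range is an infinite chain in [F]. *)
Lemma finite_chains_minimal (U : Type) (F G : set (set U)) :
  finite_chains F -> G `<=` F -> G !=set0 ->
  exists2 A, G A & forall B, G B -> ~ B `<` A.
Proof.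
move=> Ffin GF [A0 GA0]; apply: contrapT => nomin.
have /choice[g gP] : forall A, exists B, G A -> G B /\ B `<` A.
  move=> A; apply: contrapT => noB; apply: nomin; exists A.
    by apply: contrapT => nGA; apply: noB; exists A.
  by move=> B GB BA; apply: noB; exists B.
pose f n := iter n g A0.
have Gf n : G (f n) by elim: n => //= n /gP[].
have [ftot []] : total_on (range f) subset /\ ~ finite_set (range f).
  by apply: decreasing_range_infinite => n; case: (gP _ (Gf n)).
by apply: Ffin ftot => _ [n _ <-]; apply: GF.
Qed.

(** * Ideals maximal among those whose radical omits some generator *)

Definition is_ideal (R : comNzRingType) (J : set R) : Prop :=
  [/\ J 0, forall x y, J x -> J y -> J (x + y) & forall r x, J x -> J (r * x)].

Definition span (R : comNzRingType) (n : nat) (a : 'I_n -> R) : set R :=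
  [set x | exists c : 'I_n -> R, x = \sum_(i < n) c i * a i].

Section Ideals.
Variable R : comNzRingType.
Implicit Types (J P : set R) (x y r s : R).

Lemma is_ideal_span n (a : 'I_n -> R) : is_ideal (span a).
Proof.
split=> [|_ _ [c ->] [d ->]|r _ [c ->]].
- by exists (fun=> 0); rewrite big1 // => i _; rewrite mul0r.
- exists (fun i => c i + d i); rewrite -big_split /=.
  by apply: eq_bigr => i _; rewrite mulrDl.
- exists (fun i => r * c i); rewrite mulr_sumr.
  by apply: eq_bigr => i _; rewrite mulrA.
Qed.

Lemma span_gen n (a : 'I_n -> R) i : span a (a i).
Proof.
exists (fun j => (j == i)%:R); rewrite (bigD1 i) //= eqxx mul1r.
by rewrite big1 ?addr0 // => j /negbTE->; rewrite mul0r.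
Qed.

Lemma idealN J x : is_ideal J -> J x -> J (- x).
Proof. by case=> _ _ JM Jx; rewrite -mulN1r; exact: JM. Qed.

Lemma ideal_sub J x y : is_ideal J -> J (x + y) -> J x -> J y.
Proof.
move=> Ji Jxy Jx; have [_ JD _] := Ji.
by rewrite -(addKr x y); apply: JD Jxy; exact: idealN.
Qed.

Definition ideal_add J x : set R :=
  [set y | exists j r, J j /\ y = j + r * x].

Lemma is_ideal_add J x : is_ideal J -> is_ideal (ideal_add J x).
Proof.
case=> J0 JD JM; split.
- by exists 0, 0; rewrite mul0r addr0.
- move=> _ _ [j [r [Jj ->]]] [k [s [Jk ->]]].
  by exists (j + k), (r + s); split; [exact: JD|ring].
- move=> t _ [j [r [Jj ->]]].
  by exists (t * j), (t * r); split; [exact: JM|ring].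
Qed.

Lemma sub_ideal_add J x : J `<=` ideal_add J x.
Proof. by move=> j Jj; exists j, 0; rewrite mul0r addr0. Qed.

Lemma ideal_add_gen J x : is_ideal J -> ideal_add J x x.
Proof. by case=> J0 _ _; exists 0, 1; rewrite mul1r add0r. Qed.

(** For an ideal [J] this means that [span a] lies in the radical of [J]; it is tested on the
    generators only. *)
Definition in_radical n (a : 'I_n -> R) J : Prop :=
  forall i, exists k, J (a i ^+ k).

Definition radical_maximal n (a : 'I_n -> R) P : Prop :=
  [/\ is_ideal P, ~ in_radical a P &
      forall J, is_ideal J -> P `<=` J -> ~ in_radical a J -> J `<=` P].

Variables (n : nat) (a : 'I_n -> R).

Lemma radical_maximal1 P : radical_maximal a P -> ~ P 1.
Proof. by case=> _ nP _ P1; apply: nP => i; exists 0%N; rewrite expr0. Qed.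

(** If [P] contained neither [x] nor [y], maximality would put a power of each generator into both P
    + (x) and P + (y). The product of two such powers lies in [P], since [x * y] does. *)
Lemma radical_maximal_prime P x y :
  radical_maximal a P -> P (x * y) -> P x \/ P y.
Proof.
move=> [Pi nP maxP] Pxy; have [_ PD PM] := Pi.
have add_rad z : ~ P z -> in_radical a (ideal_add P z).
  move=> nPz; apply: contrapT => nrad; apply: nPz.
  apply: (maxP _ _ _ nrad); [exact: is_ideal_add|exact: sub_ideal_add|].
  exact: ideal_add_gen.
apply: contrapT => /not_orP[/add_rad xrad /add_rad yrad]; apply: nP => i.
have [k [p [r [Pp ek]]]] := xrad i; have [l [q [s [Pq el]]]] := yrad i.
exists (k + l)%N; rewrite exprD ek el.
rewrite (_ : _ * _ = (q + s * y) * p + (r * x * q + r * s * (x * y))); last by ring.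
by apply: (PD); [exact: PM|apply: PD; exact: PM].
Qed.

(** Zorn's lemma applies because there are finitely many generators: if the union of a chain
    contains a power of each, so does one member. *)
Lemma radical_maximal_exists J :
  is_ideal J -> ~ in_radical a J ->
  exists2 P, radical_maximal a P & J `<=` P.
Proof.
move=> Ji nJ.
have [||P [JP [Pi nP] maxP]] :=
  @Zorn_above R [set K | is_ideal K /\ ~ in_radical a K] J; first by [].
  move=> F FP FJ Ftot.
  have Fi K : F K -> is_ideal K by move=> /FP[].
  split.
    split.
    - by exists J => //; case: Ji.
    - move=> x y [K FK Kx] [L FL Ly].
      by case: (Ftot _ _ FK FL) => KL;
        [exists L => //; case: (Fi L FL) => _ D _; apply: D => //; apply: KL
        |exists K => //; case: (Fi K FK) => _ D _; apply: D => //; apply: KL].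
    - by move=> r x [K FK Kx]; exists K => //; case: (Fi K FK) => _ _; apply.
  move=> rad.
  have /choice[K KP] : forall i, exists K, F K /\ exists k, K (a i ^+ k).
    by move=> i; have [k [K FK Kk]] := rad i; exists K; split=> //; exists k.
  (* By totality a single member of the chain contains the finitely many K i. *)
  have [L FL KL] : exists2 L, F L & forall i, i \in enum 'I_n -> K i `<=` L.
    elim: (enum 'I_n) => [|i s [L FL KL]]; first by exists J.
    have [FK _] := KP i.
    case: (Ftot _ _ FK FL) => sub.
      by exists L => // j; rewrite inE => /predU1P[->//|/KL].
    exists (K i) => // j; rewrite inE => /predU1P[->//|/KL KjL].
    exact: subset_trans sub.
  have [_] := FP _ FL; apply=> i; have [_ [k Kk]] := KP i.
  by exists k; apply: KL Kk; rewrite mem_enum.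
exists P => //; split=> // K Ki PK nK.
by apply: maxP.
Qed.

(* Prime avoidance; incomparability comes from maximality. *)
Lemma radical_maximal_avoid (s : seq (set R)) :
  (forall P, P \in s -> radical_maximal a P) ->
  exists2 x, span a x & forall P, P \in s -> ~ P x.
Proof.
elim: s => [_|P s IHs sP].
  by exists 0 => //; case: (is_ideal_span a).
have Pmax : radical_maximal a P by apply: sP; rewrite mem_head.
have smax Q : Q \in s -> radical_maximal a Q.
  by move=> Qs; apply: sP; rewrite inE Qs orbT.
have [y Iy ys] := IHs smax.
have [Py|nPy] := pselect (P y); last first.
  by exists y => // Q; rewrite inE => /predU1P[->|/ys].
have Pns : P \notin s by apply/negP => /ys.
have [Pi nP _] := Pmax.
have [i nPai] : exists i, ~ P (a i).
  apply: contrapT => nex; apply: nP => i; exists 1%N; rewrite expr1.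
  by apply: contrapT => nPai; apply: nex; exists i.
have /choice[b bP] : forall Q, exists b, Q \in s -> Q b /\ ~ P b.
  move=> Q; apply: contrapT => nob.
  have Qs : Q \in s by apply: contrapT => Qns; apply: nob; exists 0.
  have QP : Q `<=` P.
    by move=> z Qz; apply: contrapT => nPz; apply: nob; exists z.
  have [_ _ Qtop] := smax Q Qs.
  have PQ := Qtop P Pi QP nP.
  by move: Pns; rewrite (_ : P = Q) ?Qs //; apply/seteqP.
have nPprod : ~ P (\prod_(Q <- s) b Q).
  rewrite big_seq; elim/big_ind: _ => [|u v nu nv /(radical_maximal_prime Pmax)[]|Q Qs] //.
    exact: radical_maximal1.
  by have [] := bP Q Qs.
have [_ ID IM] := is_ideal_span a.
(* The added term lies in every [Q] of [s] through the factor [b Q], whereas [y] does not; it lies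
   outside the prime [P], which contains [y]. *)
exists (y + (\prod_(Q <- s) b Q) * a i).
  by apply: ID => //; apply: IM; exact: span_gen.
move=> Q; rewrite inE => /predU1P[->|Qs] Qx.
  by have /(radical_maximal_prime Pmax)[] := ideal_sub Pi Qx Py.
have [Qi _ _] := smax Q Qs.
apply: (ys Q Qs); move: Qx; rewrite addrC => Qx.
apply: (ideal_sub Qi Qx).
have [_ _ QM] := Qi; rewrite mulrC; apply: (QM).
by rewrite (big_rem Q) //= mulrC; apply: QM; have [] := bP Q Qs.
Qed.

End Ideals.

(** * Localizations and t-linked overrings *)

Definition localization (R : idomainType) (S : set R) : set {fraction R} :=
  [set y | exists r s, S s /\ y = tofrac r / tofrac s].

Definition mult_set (R : idomainType) (S : set R) : Prop :=
  [/\ S 1, ~ S 0 & forall s t, S s -> S t -> S (s * t)].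

Section Overrings.
Variable R : idomainType.
Implicit Types (S : set R) (T : set {fraction R}).

(** This half of the equality defining t-linkedness holds for every overring. *)
Lemma colon_ideal_extension_sub T (I : set R) :
  is_overring T -> T `<=` colon T (ideal_extension I T).
Proof.
move=> [Tsub baseT] x Tx _ [n [u [v [uI vT ->]]]].
have [_ TB TM] := Tsub.
have T0 : 0 \in T by rewrite -(subrr 1); apply: TB; case: Tsub.
have TD y z : y \in T -> z \in T -> y + z \in T.
  by move=> Ty Tz; rewrite -(opprK z) -[- z]sub0r TB // TB.
apply/set_mem; apply: (TM); first exact/mem_set.
elim/big_ind: _ => // i _; apply: TM; last exact/mem_set/vT.
by apply/mem_set/baseT; have [r _ <-] := uI i; exists r.
Qed.

Lemma ideal_inverse_spanP n (a : 'I_n -> R) y :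
  ideal_inverse (span a) y <-> forall i, base_ring R (y * tofrac (a i)).
Proof.
split=> [Iy i|ya _ [x [c ->] <-]].
  by apply: Iy; exists (a i) => //; exact: span_gen.
have /choice[d dP] : forall i, exists d, tofrac d = y * tofrac (a i).
  by move=> i; have [d _ <-] := ya i; exists d.
exists (\sum_i c i * d i) => //; rewrite !rmorph_sum mulr_sumr.
by apply: eq_bigr => i _; rewrite !rmorphM /= dP mulrCA.
Qed.

(* That is, I^-1 = R implies (I^k)^-1 = R. *)
Lemma ideal_inverse_powers n (a : 'I_n -> R) (k : 'I_n -> nat) y :
  ideal_inverse (span a) = base_ring R ->
  (forall i, base_ring R (y * tofrac (a i) ^+ k i)) -> base_ring R y.
Proof.
move=> Iinv; have [m] := ubnP (\sum_i k i).
elim: m => // m IHm in k y *; rewrite ltnS => km yk.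
have [[i ki0]|kpos] := pselect (exists i, k i = 0%N).
  by have := yk i; rewrite ki0 expr0 mulr1.
(* All exponents are now positive. Each [y * a j] satisfies the hypothesis with the exponent at [j]
   lowered by one, so by induction it lies in R, and [y] lies in I^-1 = R. *)
rewrite -Iinv; apply/ideal_inverse_spanP => j.
have kj : (0 < k j)%N by rewrite lt0n; apply/eqP => kj0; apply: kpos; exists j.
apply: (IHm (fun i => k i - (i == j))%N) => [|i].
  apply: leq_trans km; rewrite [ltnLHS](bigD1 j) //= [ltnRHS](bigD1 j) //=.
  rewrite eqxx subn1 -addSn prednK // leq_add2l.
  by apply: leq_sum => i /negbTE->; rewrite subn0.
have [->|_] := eqVneq i j.
  by rewrite -mulrA -exprS subn1 prednK.
have [r _ er] := yk i; exists (r * a j) => //.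
by rewrite rmorphM /= er subn0 mulrAC.
Qed.

(** If a power of each generator were a multiple of [x], then [y * x] in R would force [y] in R. For
    [x] nonzero, taking y = 1/x makes [x] a unit, so I = R; for [x = 0] every fraction lies in R,
    which is then a field. *)
Lemma principal_not_in_radical n (a : 'I_n -> R) x :
  ~ GRing.field_axiom R -> ideal_inverse (span a) = base_ring R ->
  ~ span a 1 -> span a x -> ~ in_radical a (range ( *%R x)).
Proof.
move=> nfield Iinv I1 Ix /choice[k rad].
have basey y : base_ring R (y * tofrac x) -> base_ring R y.
  move=> [r _ er]; apply: (ideal_inverse_powers (k := k) Iinv) => i.
  have [s _ es] := rad i; exists (r * s) => //.
  by rewrite -rmorphXn /= -es !rmorphM /= er mulrA.
have [x0|x0] := eqVneq x 0.
  apply: nfield => r r0; have [|s _ es] := basey (tofrac r)^-1.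
    by rewrite x0 rmorph0 mulr0; exists 0; rewrite ?rmorph0.
  apply/unitrPr; exists s; apply/eqP; rewrite -tofrac_eq rmorphM rmorph1 /= es.
  by rewrite mulfV // tofrac_eq0.
have [|s _ es] := basey (tofrac x)^-1.
  by exists 1 => //; rewrite rmorph1 mulVf // tofrac_eq0.
apply: I1; have [_ _ IM] := is_ideal_span a.
rewrite (_ : 1 = s * x); first exact: IM.
by apply/eqP; rewrite -tofrac_eq rmorphM rmorph1 /= es mulVf // tofrac_eq0.
Qed.

Lemma is_overring_localization S : mult_set S -> is_overring (localization S).
Proof.
move=> [S1 nS0 SM].
have Sneq0 s : S s -> tofrac s != 0 :> {fraction R}.
  by move=> Ss; rewrite tofrac_eq0; apply/eqP => s0; apply: nS0; rewrite -s0.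
have baseT : base_ring R `<=` localization S.
  by move=> _ [r _ <-]; exists r, 1; rewrite rmorph1 divr1.
split=> //; split.
- by apply/mem_set/baseT; exists 1; rewrite ?rmorph1.
- move=> x y /set_mem[r [s [Ss ->]]] /set_mem[q [t [St ->]]]; apply/mem_set.
  exists (r * t - q * s), (s * t); split; first exact: SM.
  by rewrite rmorphB !rmorphM /= -!mulNr addf_div ?Sneq0.
- move=> x y /set_mem[r [s [Ss ->]]] /set_mem[q [t [St ->]]]; apply/mem_set.
  exists (r * q), (s * t); split; first exact: SM.
  by rewrite !rmorphM /= mulf_div.
Qed.

(** If each [x * a i] has a denominator [s i] in [S], the product [d] of these finitely many
    denominators puts [x * d] into I^-1 = R, so [x] is a fraction over [d]. *)
Lemma t_linked_localization S :
  mult_set S -> t_linked_overring (localization S).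
Proof.
move=> Smult; have Tover := is_overring_localization Smult.
split=> // _ [n [a ->]] Iinv; apply/seteqP; split; last first.
  exact: colon_ideal_extension_sub.
move=> x xT; have [S1 nS0 SM] := Smult.
have Sneq0 s : S s -> tofrac s != 0 :> {fraction R}.
  by move=> Ss; rewrite tofrac_eq0; apply/eqP => s0; apply: nS0; rewrite -s0.
have xa i : localization S (x * tofrac (a i)).
  apply: xT; exists 1%N, (fun=> tofrac (a i)), (fun=> 1); split=> [_|_|].
  - by exists (a i) => //; exact: span_gen.
  - by exists 1, 1; rewrite rmorph1 divr1.
  - by rewrite big_ord1 mulr1.
have /choice[s sP] : forall i, exists s,
    S s /\ base_ring R (x * tofrac (a i) * tofrac s).
  move=> i; have [r [s [Ss ->]]] := xa i.
  by exists s; split=> //; exists r; rewrite ?divfK ?Sneq0.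
pose d := \prod_i s i.
have Sd : S d by rewrite /d; elim/big_ind: _ => // i _; case: (sP i).
have : ideal_inverse (span a) (x * tofrac d).
  apply/ideal_inverse_spanP => i; rewrite /d (bigD1 i) //=.
  have [_ [r _ er]] := sP i; exists (r * \prod_(j | j != i) s j) => //.
  by rewrite !rmorphM /= er; ring.
rewrite Iinv => -[r _ er]; exists r, d; split=> //.
by rewrite er mulfK ?Sneq0.
Qed.

(** The inverse of [x] is lost: 1/x = r/s with [s] in [S'] would give [s = r * x], a multiple of [x]
    in [S']. *)
Lemma localization_proper_sub S S' x :
  mult_set S -> mult_set S' -> S' `<=` S -> S x ->
  (forall r, ~ S' (r * x)) -> localization S' `<` localization S.
Proof.
move=> [_ nS0 _] [_ nS'0 _] S'S Sx nS'x; split.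
  by move=> _ [r [s [Ss ->]]]; exists r, s; split=> //; exact: S'S.
have xinv : localization S (tofrac x)^-1.
  by exists 1, x; rewrite rmorph1 mul1r.
have x0 : x != 0 by apply/eqP => x0; apply: nS0; rewrite -x0.
move=> /(_ _ xinv)[r [s [S's /eqP e]]]; apply: (nS'x r).
have s0 : s != 0 by apply/eqP => s0; apply: nS'0; rewrite -s0.
rewrite (_ : r * x = s) //; apply/eqP; rewrite -tofrac_eq rmorphM /= eq_sym.
by move: e; rewrite -[_^-1]div1r eqr_div ?tofrac_eq0 // mul1r.
Qed.

Lemma mult_set_avoid n (a : 'I_n -> R) (l : seq (set R)) :
  (forall P, P \in l -> radical_maximal a P) ->
  mult_set [set s | s != 0 /\ forall P, P \in l -> ~ P s].
Proof.
move=> lP; split=> [|[]|s t [s0 sl] [t0 tl]].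
- by split=> [|P /lP]; [exact: oner_neq0|exact: radical_maximal1].
- by rewrite eqxx.
- split=> [|P Pl /(radical_maximal_prime (lP P Pl))[]]; first by rewrite mulf_neq0.
    exact: sl.
  exact: tl.
Qed.

Lemma finite_chains_inverse_trivial (I : set R) :
  ~ GRing.field_axiom R -> finite_chains (@t_linked_overring R) ->
  fg_ideal I -> ideal_inverse I = base_ring R -> I 1.
Proof.
move=> nfield tfin [n [a ->]] Iinv; rewrite -/(span a) in Iinv *.
apply: contrapT => I1.
(* For empty [l] only the condition [s != 0] keeps zero out of the denominators. *)
pose avoiding (l : seq (set R)) := [set s | s != 0 /\ forall P, P \in l -> ~ P s].
pose G := [set T | exists2 l,
  (forall P, P \in l -> radical_maximal a P) & T = localization (avoiding l)].
have [||_ [l lP ->] minl] := @finite_chains_minimal _ _ G tfin.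
- move=> _ [l lP ->]; apply: t_linked_localization; exact: mult_set_avoid lP.
- by exists (localization (avoiding [::])), [::].
have nrad x : span a x -> exists2 P, radical_maximal a P & P x.
  move=> Ix; have [||P Pmax xP] := @radical_maximal_exists R n a (range ( *%R x)).
  - split=> [|_ _ [r _ <-] [s _ <-]|r _ [s _ <-]].
    + by exists 0; rewrite ?mulr0.
    + by exists (r + s); rewrite ?mulrDr.
    + by exists (r * s) => //; rewrite mulrCA.
  - exact: principal_not_in_radical.
  by exists P => //; apply: xP; exists 1; rewrite ?mulr1.
(* Adding a prime over 0 keeps the avoiding element away from 0. *)
have [|P0 P0max P00] := nrad 0; first by case: (is_ideal_span a).
have [|x Ix xl] := @radical_maximal_avoid R n a (P0 :: l).
  by move=> P; rewrite inE => /predU1P[->//|/lP].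
have [P Pmax Px] := nrad x Ix.
have Pl Q : Q \in P :: l -> radical_maximal a Q.
  by rewrite inE => /predU1P[->//|/lP].
(* [x] is a denominator for [l], but all its multiples lie in [P]; so adding [P] to [l] shrinks the
   localization strictly. *)
apply: (minl (localization (avoiding (P :: l)))); first by exists (P :: l).
apply: (@localization_proper_sub _ _ x).
- exact: mult_set_avoid lP.
- exact: mult_set_avoid Pl.
- by move=> s [s0 sl]; split=> // Q Ql; apply: sl; rewrite inE Ql orbT.
- split=> [|Q Ql]; last by apply: xl; rewrite inE Ql orbT.
  by apply/eqP => x0; apply: (xl P0); rewrite ?mem_head // x0.
- move=> r [_ /(_ P)]; rewrite mem_head => /(_ isT); apply.
  by have [[_ _ PM] _ _] := Pmax; exact: PM.
Qed.

Lemma overring_t_linked T :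
  (forall I : set R, fg_ideal I -> ideal_inverse I = base_ring R -> I 1) ->
  is_overring T -> t_linked_overring T.
Proof.
move=> inv1 Tover; split=> // I Ifg Iinv; apply/seteqP; split; last first.
  exact: colon_ideal_extension_sub.
move=> x xT; rewrite -[x]mulr1; apply: xT.
exists 1%N, (fun=> 1), (fun=> 1); split=> [_|_|].
- by exists 1; [exact: inv1|rewrite rmorph1].
- by have [[T1 _ _] _] := Tover; exact: set_mem.
- by rewrite big_ord1 mulr1.
Qed.

End Overrings.

Theorem proposition2p4 (R : idomainType) :
  ~ GRing.field_axiom R ->
  (FC_domain R <-> finite_chains (@t_linked_overring R)).
Proof.
move=> nfield; split=> [fc C Ct|tfin C Co].
  by apply: fc => T /Ct[].
(* [tfin] serves twice: it bounds the chain [C], and it forces [I 1] whenever I^-1 = R, which makes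
   the members of [C] t-linked. *)
apply: (tfin) => T /Co; apply: overring_t_linked => I.
exact: finite_chains_inverse_trivial.
Qed.
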